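(* Let $(X,d)$ be a compact metric space and let $F\subseteq X$ be explicitly closed w.r.t. $(AF_k)$. Let $(\phi_n)$ be a sequence of functions $\phi_n:X\times X\to\mathbb{R}_+$. Assume that $\phi_n\nearrow\phi$ uniformly and that $\psi\preceq^A\phi_n$ for all $n$, where $A:\mathbb{N}\to\mathbb{N}$ and where $\psi,\phi:X\times X\to\mathbb{R}_+$ are uniformly consistent as well as continuous in their left arguments. If $(x_n)\subseteq X$ is such that there exists a nondecreasing function $f:\mathbb{N}\to\mathbb{N}$ with $f(n)\leq n$ and $f(n)\to\infty$ for $n\to\infty$ such that $(x_n)$ is partially $(\phi_n)$-$(G,H)$-quasi-Fej\'er monotone w.r.t. $F$, $f$ and $(\varepsilon_n)$, and $(x_{2f(n)})_n$ has the $\liminf$-property w.r.t. $F$ and $(AF_k)$, then $(x_n)$ converges to some $x^*\in F$. In particular, with all other assumptions unchanged, the conclusion that $(x_n)$ converges to some $x^*\in F$ holds if $\psi$ and $\phi$, instead of being uniformly consistent, are continuous also in their right arguments and additionally $$\psi(x,y)=0\leftrightarrow d(x,y)=0\leftrightarrow\phi(x,y)=0$$ for all $x,y\in X$. If $\phi_n=\phi$ and $\varepsilon_n=0$ for all $n$, then it suffices (instead of the $\liminf$-property) that $(x_{2f(n)})_n$ has approximate $F$-points w.r.t. $(AF_k)$.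
   Context: $\mathbb{N}=\{0,1,2,\dots\}$, $\mathbb{R}_+=[0,\infty)$. $F\subseteq X$ is nonempty and $F=\bigcap_{k\in\mathbb{N}}AF_k$ for sets $AF_k\subseteq X$ with $AF_k\supseteq AF_{k+1}$. $(\varepsilon_n)\subseteq\mathbb{R}_+$ with $\sum\varepsilon_n<\infty$. The functions $G,H:\mathbb{R}_+\to\mathbb{R}_+$ satisfy, for every $(a_n)\subseteq\mathbb{R}_+$: $a_n\to0$ implies $G(a_n)\to0$; and $H(a_n)\to0$ implies $a_n\to0$. - $F$ is explicitly closed w.r.t. $(AF_k)$: for all $p\in X$, if $AF_M\cap\overline{B}(p,\frac1{N+1})\neq\emptyset$ for all $N,M\in\mathbb{N}$, then $p\in F$ (closed balls w.r.t. $d$). - $\phi_n\nearrow\phi$ uniformly: for every $k\in\mathbb{N}$ there is $N$ such that $\phi_n(x,y)\leq\phi(x,y)+\frac1{k+1}$ for all $n\geq N$ and $x,y\in X$. - $\psi\preceq^A\phi$: $\phi(x,y)\leq\frac1{A(k)+1}\to\psi(x,y)\leq\frac1{k+1}$ for all $k\in\mathbb{N}$, $x,y\in X$. - $\phi$ is uniformly consistent if there are $\lambda,\Lambda:\mathbb{N}\to\mathbb{N}$ such that for all $k$, $x,y$: $\phi(x,y)\leq\frac1{\lambda(k)+1}\to d(x,y)\leq\frac1{k+1}$ and $d(x,y)\leq\frac1{\Lambda(k)+1}\to\phi(x,y)\leq\frac1{k+1}$. - $(x_n)$ is partially $(\phi_n)$-$(G,H)$-quasi-Fej\'er monotone w.r.t.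 $F$, $f$ and $(\varepsilon_n)$ if for all $n,m\in\mathbb{N}$ and $p\in F$: $H(\phi_{2(n+m)}(p,x_{2(n+m)}))\leq G(\phi_{2n}(p,x_{2n}))+\sum_{i=n}^{n+m-1}\varepsilon_i$ and $H(\phi_{2(n+m)+1}(p,x_{2(n+m)+1}))\leq G(\phi_{2f(n)}(p,x_{2f(n)}))+\sum_{i=f(n)}^{n+m}\varepsilon_i$. - $(y_n)$ has the $\liminf$-property w.r.t. $F$ and $(AF_k)$: $\forall k,n\,\exists N\geq n\,(y_N\in AF_k)$. $(y_n)$ has approximate $F$-points w.r.t. $(AF_k)$: $\forall k\,\exists N\,(y_N\in AF_k)$. *)

(* Defs.v *)
From mathcomp Require Import all_boot all_order all_algebra.
From mathcomp Require Import all_classical all_reals all_analysis.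

Set Implicit Arguments.
Unset Strict Implicit.
Unset Printing Implicit Defensive.

Import Order.TTheory GRing.Theory Num.Theory.
Import numFieldNormedType.Exports.

Local Open Scope classical_set_scope.
Local Open Scope ring_scope.

(* The ball [{x | d(p, x) <= r}]; the library's [closed_ball] is instead the
   topological closure of the open ball. *)
Definition mclosed_ball (R : realType) (X : metricType R) (p : X) (r : R) :
  set X := [set x | mdist p x <= r].

Definition explicitly_closed (R : realType) (X : metricType R)
    (F : set X) (AF : nat -> set X) : Prop :=
  forall p : X,
    (forall N M : nat, AF M `&` mclosed_ball p (N.+1%:R^-1) !=set0) -> F p.

(* Maps into [0, +oo[ are represented by nonnegative R-valued maps; a map on
   [0, +oo[ is a map on R whose values at negative arguments are irrelevant. *)
Definition nonneg2 (R : realType) (X : Type) (phi : X -> X -> R) : Prop :=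
  forall x y, 0 <= phi x y.

Definition nonneg_on_nonneg (R : realType) (G : R -> R) : Prop :=
  forall a, 0 <= a -> 0 <= G a.

Definition preserves_null (R : realType) (G : R -> R) : Prop :=
  forall a : nat -> R, (forall n, 0 <= a n) ->
    a n @[n --> \oo] --> (0 : R) -> G (a n) @[n --> \oo] --> (0 : R).

Definition reflects_null (R : realType) (H : R -> R) : Prop :=
  forall a : nat -> R, (forall n, 0 <= a n) ->
    H (a n) @[n --> \oo] --> (0 : R) -> a n @[n --> \oo] --> (0 : R).

(* One-sided: [phi_ n] is only bounded above by [phi] up to a uniform error. *)
Definition uniformly_upto (R : realType) (X : Type)
    (phi_ : nat -> X -> X -> R) (phi : X -> X -> R) : Prop :=
  forall k : nat, exists N : nat, forall n : nat, (N <= n)%N ->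
    forall x y : X, phi_ n x y <= phi x y + k.+1%:R^-1.

Definition dominated_with (R : realType) (X : Type) (A : nat -> nat)
    (psi phi : X -> X -> R) : Prop :=
  forall (k : nat) (x y : X),
    phi x y <= (A k).+1%:R^-1 -> psi x y <= k.+1%:R^-1.

Definition uniformly_consistent (R : realType) (X : metricType R)
    (phi : X -> X -> R) : Prop :=
  exists lambda Lambda : nat -> nat, forall (k : nat) (x y : X),
    (phi x y <= (lambda k).+1%:R^-1 -> mdist x y <= k.+1%:R^-1) /\
    (mdist x y <= (Lambda k).+1%:R^-1 -> phi x y <= k.+1%:R^-1).

Definition continuous_in_left (R : realType) (X : metricType R)
    (phi : X -> X -> R) : Prop :=
  forall y : X, continuous (fun x : X => phi x y).

Definition continuous_in_right (R : realType) (X : metricType R)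
    (phi : X -> X -> R) : Prop :=
  forall x : X, continuous (fun y : X => phi x y).

Definition partially_quasi_fejer (R : realType) (X : Type)
    (phi_ : nat -> X -> X -> R) (G H : R -> R) (F : set X)
    (f : nat -> nat) (eps : nat -> R) (x : nat -> X) : Prop :=
  forall (n m : nat) (p : X), F p ->
    H (phi_ (2 * (n + m))%N p (x (2 * (n + m))%N))
      <= G (phi_ (2 * n)%N p (x (2 * n)%N))
         + \sum_(n <= i < n + m) eps i
    /\
    H (phi_ (2 * (n + m) + 1)%N p (x (2 * (n + m) + 1)%N))
      <= G (phi_ (2 * f n)%N p (x (2 * f n)%N))
         + \sum_(f n <= i < (n + m).+1) eps i.

Definition liminf_property (X : Type) (AF : nat -> set X)
    (y : nat -> X) : Prop :=
  forall k n : nat, exists N : nat, (n <= N)%N /\ AF k (y N).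

Definition approximate_points (X : Type) (AF : nat -> set X)
    (y : nat -> X) : Prop :=
  forall k : nat, exists N : nat, AF k (y N).

Definition converges_into (R : realType) (X : metricType R) (F : set X)
    (x : nat -> X) : Prop :=
  exists xs : X, F xs /\ x n @[n --> \oo] --> xs.

(* Main.v *)
Require Import Defs.
From mathcomp Require Import all_boot all_order all_algebra.
From mathcomp Require Import all_classical all_reals all_analysis.
Import Order.TTheory GRing.Theory Num.Theory.
Import numFieldNormedType.Exports.
Local Open Scope classical_set_scope.
Local Open Scope ring_scope.

Set Implicit Arguments.
Unset Strict Implicit.

(** The theorem is a trapping argument.  Compactness and explicit closedness
    give a point [p] of [F] to which the even-indexed subsequence comes
    arbitrarily close at late indices ([cluster_point_in_F]).  At such an index
    [N] the value [phi_ (2 * N) p (x (2 * N))] is small, since [phi p] is small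
    near [p] and [phi_ n] exceeds [phi] only by a uniformly vanishing error;
    the tail of [eps] from [N] on is small by summability.  The first Fejer
    inequality, read through the moduli of [G] and [H], then keeps all later
    even terms small; the second one, started at [f n], transfers this to the
    odd terms because [f] tends to infinity ([fejer_trapping]).  Finally
    smallness of [phi_ n p (x n)] forces smallness of [psi p (x n)], which
    forces [x n] to be near [p].

    Only the single point [p] occurs in the left arguments, so the uniform
    consistency of [phi] and [psi] enters only pointwise: [mdist p] controls
    [phi p], and [psi p] controls [mdist p], in the sense of [controls] below.
    These two facts also follow from separation and continuity in the right
    argument, the second one because a positive continuous function on the
    compact complement of a neighbourhood of [p] is bounded away from zero;
    this is why both variants have the same proof.  In the stationary case
    without errors, one index at which the sequence is close to [p] suffices
    for the trapping, so that late indices are not required and approximate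
    points can replace the liminf property. *)

(** * Moduli of smallness *)

(** The epsilon-delta form of: along sequences in [D], if [g] tends to zero
    then so does [h]. *)
Definition controls (R : realType) (T : Type) (D : set T) (g h : T -> R) :
  Prop :=
  forall e, 0 < e -> exists2 d, 0 < d & forall t, D t -> g t <= d -> h t <= e.

(** If control fails at some level, choosing a witness for each bound
    [1 / (n + 1)] gives a sequence refuting the sequential property. *)
Lemma controls_of_sequences (R : realType) (T : Type) (D : set T)
    (g h : T -> R) :
  (forall t, D t -> 0 <= g t) ->
  (forall a : nat -> T, (forall n, D (a n)) ->
    g (a n) @[n --> \oo] --> (0 : R) -> h (a n) @[n --> \oo] --> (0 : R)) ->
  controls D g h.
Proof.
move=> g_ge0 gh e e0; apply: contrapT => nctrl.
have bad n : exists t, [/\ D t, g t <= n.+1%:R^-1 & e < h t].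
  apply: contrapT => nbad; apply: nctrl; exists n.+1%:R^-1 => // t Dt gt.
  by rewrite leNgt; apply/negP => eh; apply: nbad; exists t.
have [a aP] := choice bad.
have Da n : D (a n) by have [] := aP n.
have ga0 : g (a n) @[n --> \oo] --> (0 : R).
  apply: (squeeze_cvgr _ (@cvg_cst _ _ _ _ _) (@cvg_harmonic R)).
  near=> n; have [Dan gan _] := aP n.
  by rewrite g_ge0.
have /cvgrPdist_lt /(_ e e0) [N _ /(_ N (leqnn N))] := gh a Da ga0.
rewrite /= sub0r normrN; have [_ _ eh] := aP N.
by move/(le_lt_trans (ler_norm _)); rewrite ltNge (ltW eh).
Unshelve. all: by end_near.
Qed.

Lemma preserves_null_controls (R : realType) (G : R -> R) :
  preserves_null G -> controls [set a | 0 <= a] id G.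
Proof. by move=> Gnull; apply: controls_of_sequences. Qed.

Lemma reflects_null_controls (R : realType) (H : R -> R) :
  nonneg_on_nonneg H -> reflects_null H -> controls [set a | 0 <= a] H id.
Proof. by move=> H0 Hnull; apply: controls_of_sequences. Qed.

Lemma inv_succ_lt (R : realType) (e : R) :
  0 < e -> exists k : nat, k.+1%:R^-1 < e.
Proof. by move=> /ltr_add_invr[k]; rewrite add0r; exists k. Qed.

Lemma uniformly_consistent_controls (R : realType) (X : metricType R)
    (phi : X -> X -> R) (p : X) : uniformly_consistent phi ->
  controls setT (mdist p) (phi p) /\ controls setT (phi p) (mdist p).
Proof.
move=> [lambda [Lambda phiP]]; split=> e /inv_succ_lt[k ke].
  exists (Lambda k).+1%:R^-1 => // y _ dy.
  exact: le_trans ((phiP k p y).2 dy) (ltW ke).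
exists (lambda k).+1%:R^-1 => // y _ py.
exact: le_trans ((phiP k p y).1 py) (ltW ke).
Qed.

Lemma right_continuous_controls (R : realType) (X : metricType R)
    (phi : X -> X -> R) (p : X) : continuous_in_right phi -> phi p p = 0 ->
  controls setT (mdist p) (phi p).
Proof.
move=> phi_cont phipp e e0.
have /cvgrPdist_lt /(_ e e0) := phi_cont p p.
rewrite phipp => /nbhs_ballP[r /= r0 rP].
exists (r / 2) => [|y _ dy]; first by rewrite divr_gt0.
have : ball p r y.
  by rewrite ballEmdist /= (le_lt_trans dy)// ltr_pdivrMr// ltr_pMr// ltr1n.
move/rP; rewrite /= sub0r normrN => /(le_lt_trans (ler_norm _)).
exact: ltW.
Qed.

(** Outside a neighbourhood of [p], the minimum of [psi p] is attained by
    compactness, and it is positive by separation. *)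
Lemma compact_separating_controls (R : realType) (X : metricType R)
    (psi : X -> X -> R) (p : X) : compact [set: X] ->
  nonneg2 psi -> continuous_in_right psi ->
  (forall y, psi p y = 0 -> mdist p y = 0) ->
  controls setT (psi p) (mdist p).
Proof.
move=> Xc psi0 psi_cont psi_sep e e0.
(* Taking the interior of the ball makes the far set closed. *)
pose S := ~` (ball p e)^° : set X.
have near_p y : ~ S y -> mdist p y <= e.
  move=> /contrapT/interior_subset; rewrite ballEmdist /=; exact: ltW.
have Sc : compact S.
  apply: (subclosed_compact _ Xc) => //.
  by apply: open_closedC; exact: open_interior.
have [S0|/set0P S0] := eqVneq S set0.
  by exists 1 => // y _ _; apply: near_p; rewrite S0.
have [|c /set_mem Sc0 cmin] := compact_EVT_min (f := psi p) S0 Sc.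
  exact/continuous_subspaceT/psi_cont.
have c_gt0 : 0 < psi p c.
  rewrite lt_neqAle psi0 andbT eq_sym; apply/eqP => /psi_sep/mdist_positivity pc.
  by apply: Sc0; rewrite -pc; apply: nbhs_singleton; apply: nbhs_interior;
    exact: nbhsx_ballx.
exists (psi p c / 2) => [|y _ y_le]; first by rewrite divr_gt0.
apply: near_p => Sy; have := cmin y (mem_set Sy).
by rewrite leNgt (le_lt_trans y_le)// ltr_pdivrMr// ltr_pMr// ltr1n.
Qed.

(** * Trapping a partially quasi-Fejer monotone sequence *)

Lemma summable_tail (R : realType) (eps : nat -> R) : cvgn (series eps) ->
  forall e, 0 < e ->
  exists N, forall n m, (N <= n)%N -> \sum_(n <= i < m) eps i <= e.
Proof.
move=> /cvg_cauchy/cauchy_seriesP eps_tail e e0.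
have [[P1 P2] /= [[N1 _ N1P] [N2 _ N2P]] PP] := eps_tail e e0.
exists (maxn N1 N2) => n m; rewrite geq_max => /andP[N1n N2n].
have [mn|/ltnW nm] := leqP m n; first by rewrite big_geq// ltW.
have /= := PP (n, m) (conj (N1P n N1n) (N2P m (leq_trans N2n nm))).
by move/(le_lt_trans (ler_norm _)); exact: ltW.
Qed.

(** Both Fejer inequalities have the shape [H b <= G a + s] with [s] an error
    sum; the moduli of [H] and [G] combine to one bound on [a] and [s]. *)
Lemma fejer_step (R : realType) (G H : R -> R) :
  preserves_null G -> nonneg_on_nonneg H -> reflects_null H ->
  forall e, 0 < e -> exists2 d, 0 < d &
    forall a b s, 0 <= a -> 0 <= b -> a <= d -> s <= d ->
      H b <= G a + s -> b <= e.
Proof.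
move=> /preserves_null_controls Gc H0 /(reflects_null_controls H0) Hc e e0.
have [h h0 hP] := Hc e e0.
have h20 : 0 < h / 2 by rewrite divr_gt0.
have [g g0 gP] := Gc _ h20.
exists (Num.min g (h / 2)) => [|a b s a0 b0]; first by rewrite lt_min g0.
rewrite !le_min => /andP[ag _] /andP[_ sh] Hb.
by apply: hP => //; rewrite (le_trans Hb)// (splitr h) lerD// gP.
Qed.

(** The last premise gives, for every tolerance, only one even index [N] to start
    from: the first inequality at [N] bounds all later even terms.  For odd
    terms the second inequality starts at [2 * f n], which is late enough to be
    an even term already known to be small. *)
Lemma fejer_trapping (R : realType) (X : Type) (F : set X) (eps : nat -> R)
    (G H : R -> R) (phi_ : nat -> X -> X -> R) (f : nat -> nat)
    (x : nat -> X) (p : X) :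
  cvgn (series eps) ->
  preserves_null G -> nonneg_on_nonneg H -> reflects_null H ->
  (forall n, nonneg2 (phi_ n)) -> f n @[n --> \oo] --> \oo ->
  partially_quasi_fejer phi_ G H F f eps x -> F p ->
  (forall d, 0 < d -> exists N,
    phi_ (2 * N)%N p (x (2 * N)%N) <= d /\
    forall m, \sum_(N <= i < N + m) eps i <= d) ->
  forall e, 0 < e -> \forall n \near \oo, phi_ n p (x n) <= e.
Proof.
move=> eps_sum Gn H0 Hn phi0 f_oo fejer Fp start.
have step := fejer_step Gn H0 Hn.
have even_small e : 0 < e ->
    exists N, forall n, (N <= n)%N -> phi_ (2 * n)%N p (x (2 * n)%N) <= e.
  move=> /step[d /start[N [Nd Ntail]] dP]; exists N => n Nn.
  have [+ _] := fejer N (n - N)%N p Fp; rewrite subnKC// => {}fejer.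
  by apply: dP fejer; rewrite ?phi0// -(subnKC Nn) Ntail.
have odd_small e : 0 < e -> exists N, forall n, (N <= n)%N ->
    phi_ (2 * n + 1)%N p (x (2 * n + 1)%N) <= e.
  move=> /step[d d0 dP].
  have [N1 N1P] := even_small d d0.
  have [N2 N2P] := summable_tail eps_sum d0.
  have [N3 _ N3P] := (cvgnyPge _).1 f_oo (maxn N1 N2).
  exists N3 => n /N3P /=; rewrite geq_max => /andP[N1f N2f].
  have [_] := fejer n 0%N p Fp; rewrite addn0.
  by apply: dP; rewrite ?phi0 ?N1P ?N2P.
move=> e e0.
have [N1 N1P] := even_small e e0.
have [N2 N2P] := odd_small e e0.
exists (2 * maxn N1 N2).+1 => // n /= Nn.
have nE := odd_double_half n.
have : (maxn N1 N2 <= n./2)%N.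
  rewrite -leq_double -mul2n -ltnS (leq_trans Nn)// -{1}nE.
  by case: (odd n).
rewrite geq_max => /andP[N1n N2n]; rewrite -nE -mul2n addnC.
by case: (odd n); rewrite ?addn0 ?N1P ?N2P.
Qed.

(** * The limit point and convergence *)

(** A cluster point of [y] is close to [y k] for arbitrarily late [k], and
    [y k] then lies in every [AF M] with [M <= k]. *)
Lemma cluster_point_in_F (R : realType) (X : metricType R)
    (F : set X) (AF : nat -> set X) (y : nat -> X) :
  compact [set: X] -> (forall k, AF k.+1 `<=` AF k) ->
  explicitly_closed F AF -> (forall k, AF k (y k)) ->
  exists2 p, F p & forall N e, 0 < e ->
    exists2 k, (N <= k)%N & mdist p (y k) <= e.
Proof.
move=> Xc AFdecr Fcl AFy.
have AFmono M k : (M <= k)%N -> AF k `<=` AF M.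
  move=> /subnKC <-; elim: (k - M)%N => [|j IH]; first by rewrite addn0.
  by rewrite addnS => z /AFdecr/IH.
have [p [_ cl]] := Xc (y k @[k --> \oo]) _ filterT.
have close N e : 0 < e -> exists2 k, (N <= k)%N & mdist p (y k) <= e.
  move=> e0.
  have late : (y k @[k --> \oo]) [set z | exists2 k, (N <= k)%N & z = y k].
    by exists N => // k /= Nk; exists k.
  have [z [[k Nk ->]]] := cl _ _ late (nbhsx_ballx p e e0).
  by rewrite ballEmdist /= => /ltW; exists k.
exists p => //; apply: Fcl => N M.
have [|k Mk dk] := close M N.+1%:R^-1; first by rewrite invr_gt0.
by exists (y k); split => //; exact: AFmono Mk _ (AFy k).
Qed.

(** Trapping makes [phi_ n p (x n)] fall below the thresholds [1 / (A k + 1)],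
    where [dominated_with] passes to [psi p (x n)] and from there to the
    distance.  The thresholds do not depend on [n] because [A] does not. *)
Lemma fejer_converges (R : realType) (X : metricType R)
    (F : set X) (eps : nat -> R) (G H : R -> R)
    (phi_ : nat -> X -> X -> R) (psi : X -> X -> R) (A : nat -> nat)
    (f : nat -> nat) (x : nat -> X) (p : X) :
  cvgn (series eps) ->
  preserves_null G -> nonneg_on_nonneg H -> reflects_null H ->
  (forall n, nonneg2 (phi_ n)) -> (forall n, dominated_with A psi (phi_ n)) ->
  controls setT (psi p) (mdist p) -> f n @[n --> \oo] --> \oo ->
  partially_quasi_fejer phi_ G H F f eps x -> F p ->
  (forall d, 0 < d -> exists N,
    phi_ (2 * N)%N p (x (2 * N)%N) <= d /\
    forall m, \sum_(N <= i < N + m) eps i <= d) ->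
  converges_into F x.
Proof.
move=> eps_sum Gn H0 Hn phi0 dom psi_ctrl f_oo fejer Fp start.
exists p; split=> //.
apply/metricType_numDomainType.cvgrPdist_le => e e0.
have [d /inv_succ_lt[k kd] dP] := psi_ctrl e e0.
have Ak0 : 0 < (A k).+1%:R^-1 :> R by rewrite invr_gt0.
have := fejer_trapping eps_sum Gn H0 Hn phi0 f_oo fejer Fp start Ak0.
apply: filterS => n /dom psi_le.
by apply: dP => //; exact: le_trans psi_le (ltW kd).
Qed.

Lemma liminf_fejer_converges (R : realType) (X : metricType R)
    (F : set X) (AF : nat -> set X) (eps : nat -> R) (G H : R -> R)
    (phi_ : nat -> X -> X -> R) (psi phi : X -> X -> R) (A : nat -> nat)
    (f : nat -> nat) (x : nat -> X) :
  compact [set: X] -> (forall k, AF k.+1 `<=` AF k) ->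
  explicitly_closed F AF -> cvgn (series eps) ->
  preserves_null G -> nonneg_on_nonneg H -> reflects_null H ->
  (forall n, nonneg2 (phi_ n)) -> uniformly_upto phi_ phi ->
  (forall n, dominated_with A psi (phi_ n)) ->
  (forall p, controls setT (mdist p) (phi p)) ->
  (forall p, controls setT (psi p) (mdist p)) ->
  f n @[n --> \oo] --> \oo ->
  partially_quasi_fejer phi_ G H F f eps x ->
  liminf_property AF (fun n => x (2 * f n)%N) ->
  converges_into F x.
Proof.
move=> Xc AFdecr Fcl eps_sum Gn H0 Hn phi0 upto dom phi_c psi_c f_oo fejer linf.
have [s sP] := choice (fun k => linf k k).
have [p Fp close] := cluster_point_in_F Xc AFdecr Fcl (fun k => (sP k).2).
apply: (fejer_converges eps_sum Gn H0 Hn phi0 dom (psi_c p) f_oo fejer Fp).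
move=> d d0.
have d20 : 0 < d / 2 by rewrite divr_gt0.
have [r r0 rP] := phi_c p _ d20.
have [k kd] := inv_succ_lt d20.
have [N1 N1P] := upto k.
have [N2 N2P] := summable_tail eps_sum d0.
have [N3 _ N3P] := (cvgnyPge _).1 f_oo (maxn N1 N2).
have [j N3j jr] := close N3 r r0.
have := N3P (s j) (leq_trans N3j (sP j).1).
rewrite /= geq_max => /andP[N1f N2f].
exists (f (s j)); split=> [|m]; last exact: N2P.
rewrite (le_trans (N1P _ _ _ _)) ?(leq_trans N1f) ?leq_pmull//.
by rewrite (splitr d) lerD// ?rP// ltW.
Qed.

(** Here a start at any index near [p] will do: the error sums vanish, and
    [phi_] does not depend on the index. *)
Lemma stationary_fejer_converges (R : realType) (X : metricType R)
    (F : set X) (AF : nat -> set X) (G H : R -> R)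
    (psi phi : X -> X -> R) (A : nat -> nat)
    (f : nat -> nat) (x : nat -> X) :
  compact [set: X] -> (forall k, AF k.+1 `<=` AF k) ->
  explicitly_closed F AF ->
  preserves_null G -> nonneg_on_nonneg H -> reflects_null H ->
  nonneg2 phi -> dominated_with A psi phi ->
  (forall p, controls setT (mdist p) (phi p)) ->
  (forall p, controls setT (psi p) (mdist p)) ->
  f n @[n --> \oo] --> \oo ->
  partially_quasi_fejer (fun=> phi) G H F f (fun=> 0) x ->
  approximate_points AF (fun n => x (2 * f n)%N) ->
  converges_into F x.
Proof.
move=> Xc AFdecr Fcl Gn H0 Hn phi0 dom phi_c psi_c f_oo fejer appr.
have [s sP] := choice appr.
have [p Fp close] := cluster_point_in_F Xc AFdecr Fcl sP.
have sum0 : cvgn (series (fun=> 0 : R)).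
  rewrite (_ : series _ = cst 0); first exact: is_cvg_cst.
  by apply/funext => n; rewrite /series /= big1.
apply: (fejer_converges sum0 Gn H0 Hn (fun=> phi0) (fun=> dom) (psi_c p) f_oo
  fejer Fp).
move=> d d0.
have [r r0 rP] := phi_c p _ d0.
have [j _ jr] := close 0%N r r0.
exists (f (s j)); split=> [|m]; first exact: rP.
by rewrite big1// ltW.
Qed.

Unset Implicit Arguments.
Set Strict Implicit.

Theorem theorem5p7 (R : realType) (X : metricType R)
  (F : set X) (AF : nat -> set X) (eps : nat -> R) (G H : R -> R)
  (phi_ : nat -> X -> X -> R) (psi phi : X -> X -> R) (A : nat -> nat)
  (x : nat -> X) (f : nat -> nat)
  (Xcompact : compact [set: X])
  (F0 : F !=set0)
  (FE : F = \bigcap_k AF k)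
  (AFdecr : forall k : nat, AF k.+1 `<=` AF k)
  (Fclosed : explicitly_closed F AF)
  (eps_ge0 : forall n : nat, 0 <= eps n)
  (eps_summable : cvgn (series eps))
  (G_ge0 : nonneg_on_nonneg G)
  (H_ge0 : nonneg_on_nonneg H)
  (G_null : preserves_null G)
  (H_null : reflects_null H)
  (phi_n_ge0 : forall n : nat, nonneg2 (phi_ n))
  (psi_ge0 : nonneg2 psi)
  (phi_ge0 : nonneg2 phi)
  (phi_n_phi : uniformly_upto phi_ phi)
  (psi_phi_n : forall n : nat, dominated_with A psi (phi_ n))
  (psi_left : continuous_in_left psi)
  (phi_left : continuous_in_left phi)
  (f_mono : forall m n : nat, (m <= n)%N -> (f m <= f n)%N)
  (f_le : forall n : nat, (f n <= n)%N)
  (f_infty : f n @[n --> \oo] --> \oo)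
  (x_fejer : partially_quasi_fejer phi_ G H F f eps x) :
  let consistent := uniformly_consistent psi /\ uniformly_consistent phi in
  let separating :=
    [/\ continuous_in_right psi, continuous_in_right phi &
        forall u v : X, (psi u v = 0 <-> mdist u v = 0) /\
                        (mdist u v = 0 <-> phi u v = 0)] in
  let liminf := liminf_property AF (fun n => x (2 * f n)%N) in
  let approx := approximate_points AF (fun n => x (2 * f n)%N) in
  [/\ consistent -> liminf -> converges_into F x,
      separating -> liminf -> converges_into F x &
      (forall n : nat, phi_ n = phi) -> (forall n : nat, eps n = 0) ->
      consistent \/ separating -> approx -> converges_into F x].
Proof.
move=> consistent separating liminf approx.
have consistent_c : consistent ->
    (forall p, controls setT (mdist p) (phi p)) /\
    (forall p, controls setT (psi p) (mdist p)).
  move=> [psi_u phi_u]; split=> p.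
    exact: (uniformly_consistent_controls p phi_u).1.
  exact: (uniformly_consistent_controls p psi_u).2.
have separating_c : separating ->
    (forall p, controls setT (mdist p) (phi p)) /\
    (forall p, controls setT (psi p) (mdist p)).
  move=> [psi_right phi_right sep]; split=> p.
    apply: right_continuous_controls => //.
    by apply/(sep p p).2; rewrite mdistxx.
  by apply: compact_separating_controls => // y /(sep p y).1.
have converges : (forall p, controls setT (mdist p) (phi p)) /\
    (forall p, controls setT (psi p) (mdist p)) -> liminf -> converges_into F x.
  move=> [phi_c psi_c].
  exact: (liminf_fejer_converges Xcompact AFdecr Fclosed eps_summable G_null
    H_ge0 H_null phi_n_ge0 phi_n_phi psi_phi_n phi_c psi_c f_infty x_fejer).
split=> [/consistent_c|/separating_c|phiE epsE cs]; try exact: converges.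
have [phi_c psi_c] : (forall p, controls setT (mdist p) (phi p)) /\
    (forall p, controls setT (psi p) (mdist p)).
  by case: cs.
have phi_cst : phi_ = fun=> phi by apply/funext.
have eps_cst : eps = fun=> 0 by apply/funext.
rewrite phi_cst eps_cst in x_fejer.
have psi_phi : dominated_with A psi phi by rewrite -(phiE 0%N).
exact: (stationary_fejer_converges Xcompact AFdecr Fclosed G_null H_ge0 H_null
  phi_ge0 psi_phi phi_c psi_c f_infty x_fejer).
Qed.
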